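(* For any $a\in\mathbb C$, $a\neq 0$, and any $n,k\in\mathbb N_0$, the following Rodrigues-type identities for the Charlier polynomials hold (whenever the expressions involved are defined): $$C_n(x;a)=\frac{(-a)^k}{(x+1)_k}\,\Delta_n^k\,C_n(x+k;a),$$ $$C_n(x;a)=\frac{n!}{a^n}\,\Delta_n^k\left(\frac{a^{n-k}}{(n-k)!}\,C_{n-k}(x-k;a)\right).$$
   Context: $\mathbb N_0=\{0,1,2,\dots\}$; $(y)_k=y(y+1)\cdots(y+k-1)$. The Charlier polynomials are $C_n(x;a)={}_2F_0(-n,-x;-;-1/a)=\sum_{j=0}^n\frac{(-n)_j(-x)_j}{j!}(-1/a)^j$. The operator $\Delta_nf(n)=f(n+1)-f(n)$ acts on the index $n$ with $x,a$ fixed, on the whole expression to its right. Convention: $\frac{1}{m!}C_m=0$ for negative integers $m$. *)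

(* Defs.v *)
From HB Require Import structures.
From mathcomp Require Import all_boot all_order all_algebra.

Set Implicit Arguments.
Unset Strict Implicit.
Unset Printing Implicit Defensive.

Import Order.TTheory GRing.Theory Num.Theory.
Local Open Scope ring_scope.

Definition pochhammer (F : fieldType) (y : F) (k : nat) : F :=
  \prod_(i < k) (y + i%:R).

(* The series 2F0(-n, -x; -; -1/a), which terminates at j = n. *)
Definition charlier (F : fieldType) (n : nat) (x a : F) : F :=
  \sum_(j < n.+1)
    pochhammer (- n%:R) j * pochhammer (- x) j / j`!%:R * (- 1 / a) ^+ j.

(* C_m(x; a) / m! for an integer index m, equal to 0 by convention for m < 0. *)
Definition charlier_over_fact (F : fieldType) (m : int) (x a : F) : F :=
  match m with
  | Posz p => (p`!%:R)^-1 * charlier p x a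
  | Negz _ => 0
  end.

Definition fdiff (V : zmodType) (f : nat -> V) : nat -> V :=
  fun n => f n.+1 - f n.

(* Main.v *)
Require Import Defs.
From mathcomp Require Import all_boot all_order all_algebra.
From mathcomp Require Import reals.
From mathcomp Require Import complex.
From mathcomp Require Import ring.

(** In characteristic zero the hypergeometric sum is the binomial sum
    [C_n(x;a) = \sum_j 'C(n, j) (-x)_j / a^j], so each identity is a [k]-fold
    iteration of a first-order one, read off term by term.

    - Pascal's rule [C(n+1, j+1) - C(n, j+1) = C(n, j)] shows that a difference
      in [n] shifts the sum by one, and [(-x)_(j+1) = -x (1-x)_j] then turns it
      into [\Delta_n C_n(x;a) = - x / a * C_n(x-1;a)] ([fdiff_charlier]).
      Starting from [x + k], the accumulated factors [-(x+i)/a] for [0 < i <= k]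
      multiply to [(x+1)_k / (-a)^k].
    - A difference in [x] acts on the Pochhammer symbols,
      [(-x)_(j+1) - (1-x)_(j+1) = - (j+1) (1-x)_j], and
      [(j+1) C(n+1, j+1) = (n+1) C(n, j)] gives the backward relation
      [C_(n+1)(x) - C_(n+1)(x-1) = - (n+1)/a * C_n(x-1)] ([charlier_backward]).
      For the normalized functions [g_m(x) = a^m C_m(x;a) / m!] it says
      [g_m(x-1) - g_(m-1)(x-1) = g_m(x)]; this holds for every integer [m] with
      the convention [g_m = 0] for [m < 0], so it iterates freely even when
      [k > n]. *)

Set Implicit Arguments.
Unset Strict Implicit.
Unset Printing Implicit Defensive.

Import Order.TTheory GRing.Theory Num.Theory.
Local Open Scope ring_scope.

Section FiniteDifferences.

Variable V : zmodType.

Lemma eq_iter_fdiff k (f g : nat -> V) :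
  f =1 g -> iter k (@fdiff _) f =1 iter k (@fdiff _) g.
Proof. by move=> fg; elim: k => [|k IHk] n //=; rewrite /fdiff !IHk. Qed.

End FiniteDifferences.

Lemma iter_fdiff_scale (R : pzRingType) k (c : R) (f : nat -> R) n :
  iter k (@fdiff _) (fun m => c * f m) n = c * iter k (@fdiff _) f n.
Proof. by elim: k n => [|k IHk] n //=; rewrite /fdiff !IHk mulrBr. Qed.

Section Pochhammer.

Variable F : fieldType.
Implicit Types y : F.

Lemma pochhammer0 y : pochhammer y 0 = 1.
Proof. by rewrite /pochhammer big_ord0. Qed.

Lemma pochhammerSr y k : pochhammer y k.+1 = pochhammer y k * (y + k%:R).
Proof. by rewrite /pochhammer big_ord_recr. Qed.

Lemma pochhammerS y k : pochhammer y k.+1 = y * pochhammer (y + 1) k.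
Proof.
rewrite /pochhammer big_ord_recl addr0; congr (_ * _).
by apply: eq_bigr => i _; rewrite -addrA -natr1 [1 + _]addrC.
Qed.

(** Both symbols on the left share the factor [(y+1)_k]; the remaining factors
    [y] and [y + k + 1] differ by [k + 1]. *)
Lemma pochhammerB y k :
  pochhammer y k.+1 - pochhammer (y + 1) k.+1
  = - k.+1%:R * pochhammer (y + 1) k.
Proof. by rewrite pochhammerS pochhammerSr -natr1; ring. Qed.

Lemma pochhammerN_nat n j :
  pochhammer (- n%:R : F) j = (-1) ^+ j * (n ^_ j)%:R.
Proof.
elim: j => [|j IHj]; first by rewrite pochhammer0 expr0 ffactn0 mul1r.
rewrite pochhammerSr IHj ffactnSr natrM exprS.
have [le_jn|lt_nj] := leqP j n; first by rewrite natrB //; ring.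
by rewrite ffact_small // !(mul0r, mulr0).
Qed.

End Pochhammer.

Section Charlier.

Variables (F : numFieldType) (a : F).
Implicit Types x : F.

(** The summation bound may be any [N > n], since ['C(n, j)] vanishes beyond
    [n]; this lets sums of different degrees be compared term by term. *)
Lemma charlier_binomial n x N : (n < N)%N ->
  charlier n x a = \sum_(j < N) 'C(n, j)%:R * pochhammer (- x) j / a ^+ j.
Proof.
move=> ltnN; rewrite /charlier (big_ord_widen N (fun j =>
  pochhammer (- n%:R) j * pochhammer (- x) j / j`!%:R * (- 1 / a) ^+ j) ltnN).
rewrite big_mkcond.
apply: eq_bigr => j _ /=; case: ltnP => [_|lt_nj]; last first.
  by rewrite bin_small // !mul0r.
have fj : j`!%:R != 0 :> F by rewrite pnatr_eq0 -lt0n fact_gt0.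
rewrite pochhammerN_nat -bin_ffact natrM expr_div_n.
(* One sign (-1)^j comes from (-n)_j, the other from (-1/a)^j. *)
transitivity (((-1) ^+ j * (-1) ^+ j) * (j`!%:R / j`!%:R)
   * ('C(n, j)%:R * pochhammer (- x) j / a ^+ j)); first by ring.
by rewrite -expr2 sqrr_sign divff // !mul1r.
Qed.

Lemma charlier0 x : charlier 0 x a = 1.
Proof.
by rewrite (@charlier_binomial 0 x 1) // big_ord1 pochhammer0 divr1 mulr1.
Qed.

(** Pascal's rule: differencing ['C(n, j)] in [n] lowers [j] by one. *)
Lemma fdiff_charlier n x :
  fdiff (fun m => charlier m x a) n = - x / a * charlier n (x - 1) a.
Proof.
rewrite /fdiff (@charlier_binomial n.+1 x n.+2) //.
rewrite (@charlier_binomial n x n.+2) // (@charlier_binomial n (x - 1) n.+1) //.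
rewrite -sumrB big_ord_recl !bin0 subrr add0r mulr_sumr.
apply: eq_bigr => j _; rewrite lift0 binS natrD pochhammerS exprS invfM.
rewrite (_ : - (x - 1) = - x + 1); last by ring.
by ring.
Qed.

(** The difference in [x] lowers the degree because the factor [j+1] from
    [pochhammerB] is absorbed by ['C(n+1, j+1)]. *)
Lemma charlier_backward n x :
  charlier n.+1 x a - charlier n.+1 (x - 1) a
  = - n.+1%:R / a * charlier n (x - 1) a.
Proof.
rewrite !(@charlier_binomial n.+1 _ n.+2) // (@charlier_binomial n _ n.+1) //.
rewrite -sumrB big_ord_recl !pochhammer0 subrr add0r mulr_sumr.
apply: eq_bigr => j _; rewrite lift0.
rewrite (_ : - (x - 1) = - x + 1); last by ring.
rewrite -mulrBl -mulrBr pochhammerB exprS invfM.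
transitivity (- (j.+1%:R * 'C(n.+1, j.+1)%:R) * pochhammer (- x + 1) j
              * (a^-1 * (a ^+ j)^-1)); first by ring.
by rewrite -natrM -mul_bin_diag natrM; ring.
Qed.

Lemma iter_fdiff_charlier k n x :
  iter k (@fdiff _) (fun m => charlier m (x + k%:R) a) n
  = pochhammer (x + 1) k / (- a) ^+ k * charlier n x a.
Proof.
elim: k n => [|k IHk] n.
  by rewrite /= addr0 pochhammer0 divr1 mul1r.
rewrite iterSr (@eq_iter_fdiff _ k _ (fun m =>
  - (x + k.+1%:R) / a * charlier m (x + k%:R) a)); last first.
  by move=> m; rewrite fdiff_charlier -natr1 addrA addrK.
rewrite iter_fdiff_scale IHk pochhammerSr exprS invfM invrN -natr1.
by ring.
Qed.

(** The function [a^m C_m(x;a) / m!] of an integer index, for which the backward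
    relation has constant coefficients. *)
Definition charlier_normalized (m : int) x : F :=
  a ^ m * charlier_over_fact m x a.

Hypothesis a_neq0 : a != 0.

Lemma charlier_normalized_backward (m : int) x :
  charlier_normalized m (x - 1) - charlier_normalized (m - 1) (x - 1)
  = charlier_normalized m x.
Proof.
rewrite /charlier_normalized; case: m => [[|p]|p].
- by rewrite /= !charlier0 mulr0 subr0.
- have -> : Posz p.+1 - 1 = Posz p by rewrite -addn1 PoszD addrK.
  rewrite /= -!exprnP factS natrM invfM exprS.
  have := charlier_backward p x => /eqP; rewrite subr_eq => /eqP ->.
  have p1 : p.+1%:R != 0 :> F by rewrite pnatr_eq0.
  have fp : p`!%:R != 0 :> F by rewrite pnatr_eq0 -lt0n fact_gt0.
  by move: p1; rewrite -natr1 => p1; field; rewrite p1 a_neq0 fp.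
- have -> : Negz p - 1 = Negz p.+1 by rewrite !NegzE -opprD -PoszD addn1.
  by rewrite /= !mulr0 subr0.
Qed.

Lemma iter_fdiff_charlier_normalized k n x :
  iter k (@fdiff _)
    (fun m => charlier_normalized (m%:Z - k%:Z) (x - k%:R)) n
  = charlier_normalized n%:Z x.
Proof.
elim: k n => [|k IHk] n; first by rewrite /= !subr0.
rewrite iterSr -IHk; apply: eq_iter_fdiff => m; rewrite /fdiff.
(* Both indices are read relative to z = m - k: the two values of the
   difference sit at z and z - 1, at the same point (x - k) - 1. *)
have -> : m.+1%:Z - k.+1%:Z = m%:Z - k%:Z.
  by rewrite -addn1 -(addn1 k) !PoszD; ring.
have -> : m%:Z - k.+1%:Z = m%:Z - k%:Z - 1 by rewrite -(addn1 k) PoszD; ring.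
have -> : x - k.+1%:R = x - k%:R - 1 by rewrite -natr1; ring.
exact: charlier_normalized_backward.
Qed.

End Charlier.

Theorem theorem4p7 (R : realType) (a x : complex R) (n k : nat) (ha : a != 0) :
  (pochhammer (x + 1) k != 0 ->
     charlier n x a =
       (- a) ^+ k / pochhammer (x + 1) k
       * iter k (@fdiff _) (fun m : nat => charlier m (x + k%:R) a) n)
  /\
  charlier n x a =
    n`!%:R / a ^+ n
    * iter k (@fdiff _)
        (fun m : nat => a ^ (m%:Z - k%:Z)
                        * charlier_over_fact (m%:Z - k%:Z) (x - k%:R) a) n.
Proof.
split=> [hx|].
  rewrite iter_fdiff_charlier //; set q := pochhammer _ _ in hx *.
  have ak : (- a) ^+ k != 0 by rewrite expf_neq0 // oppr_eq0.
  by rewrite mulrA -invf_div mulVf ?mul1r // mulf_neq0 ?invr_eq0.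
rewrite (iter_fdiff_charlier_normalized ha) /charlier_normalized /= -exprnP.
have an : a ^+ n != 0 by rewrite expf_neq0.
have fn : n`!%:R != 0 :> complex R by rewrite pnatr_eq0 -lt0n fact_gt0.
by rewrite mulrA mulrA mulfVK // divff // mul1r.
Qed.
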